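(* For every integer $p\ge 3$ there is a constant $c_p>0$ such that every finite weighted graph with no $K_{3,p}$ minor has a $2$-dimensional control function $D_p$ with $D_p(r)\le c_p r+c_p$ for all $r>0$. Moreover, for every $\varepsilon>0$ there is a constant $c=c(\varepsilon)>0$ such that every finite weighted graph with no $K_{3,p}$ minor and all edge weights at least $\varepsilon$ has a $2$-dimensional control function $D$ with $D(r)\le c\,p^2 r$ for all $r>0$. In particular, the class of finite weighted graphs with no $K_{3,p}$ minor has asymptotic dimension at most $2$ of linear type, and the class of finite unweighted graphs with no $K_{3,p}$ minor has Assouad–Nagata dimension at most $2$.
   Context: A weighted graph $(G,\ell)$ is a graph with positive real edge weights $(\ell_e)$; it is viewed as a metric space on $V(G)$ with the weighted shortest-path distance (infinite between different components); unweighted graphs have all weights $1$. A graph $H$ is a minor of $G$ if it can be obtained from $G$ by deleting vertices and edges and contracting edges. For a metric space $(X,d)$, a family $\mathcal U$ of subsets is $D$-bounded if every member has diameter at most $D$, and $r$-disjoint if points in different members are at distance $>r$. A function $D:\mathbb{R}^+\to\mathbb{R}^+$ is an $n$-dimensional control function for $X$ if for every $r>0$ there is a cover $\mathcal U=\mathcal U_1\cup\dots\cup\mathcal U_{n+1}$ of $X$ with each $\mathcal U_i$ $r$-disjoint and each member $D(r)$-bounded. A family of metric spaces has asymptotic dimension at most $n$ of linear type if there is a constant $c>0$ such that a single function $D$ with $D(r)\le cr+c$ is an $n$-dimensional control function for all members; it has Assouad–Nagata dimension at most $n$ if such a $D$ with $D(r)\le cr$ exists. *)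

(* Defs.v *)
From HB Require Import structures.
From mathcomp Require Import all_boot all_order all_algebra.
From mathcomp Require Import classical_sets reals ereal Rstruct.
Set Implicit Arguments. Unset Strict Implicit. Unset Printing Implicit Defensive.
Import Order.TTheory GRing.Theory Num.Theory.
Local Open Scope ring_scope.

Notation R := Rdefinitions.R.

Definition simple_graph (T : finType) (e : rel T) : Prop :=
  (forall x y, e x y = e y x) /\ (forall x, ~~ e x x).

Definition edge_weights (T : finType) (e : rel T) (w : T -> T -> R) : Prop :=
  forall x y, e x y -> 0 < w x y /\ w x y = w y x.

Definition walk (T : finType) (e : rel T) (x y : T) (s : seq T) : bool :=
  path e x s && (last x s == y).

Definition walk_weight (T : finType) (w : T -> T -> R) (x : T) (s : seq T) : R :=
  \sum_(c <- pairmap w x s) c.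

(* Weighted shortest-path distance (+oo between different components). *)
Definition gdist (T : finType) (e : rel T) (w : T -> T -> R) (x y : T) : \bar R :=
  ereal_inf [set (walk_weight w x s)%:E | s in [set s | walk e x y s]]%classic.

Definition bounded_family (T : finType) (e : rel T) (w : T -> T -> R)
    (D : R) (U : {set {set T}}) : Prop :=
  forall A, A \in U -> forall x y, x \in A -> y \in A -> (gdist e w x y <= D%:E)%E.

Definition disjoint_family (T : finType) (e : rel T) (w : T -> T -> R)
    (r : R) (U : {set {set T}}) : Prop :=
  forall A B, A \in U -> B \in U -> A != B ->
    forall x y, x \in A -> y \in B -> (r%:E < gdist e w x y)%E.

Definition control_function (T : finType) (e : rel T) (w : T -> T -> R)
    (n : nat) (D : R -> R) : Prop :=
  (forall r, 0 < r -> 0 < D r) /\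
  forall r, 0 < r ->
    exists U : 'I_n.+1 -> {set {set T}},
      (forall x : T, exists i, exists2 A, A \in U i & x \in A) /\
      (forall i, disjoint_family e w r (U i)) /\
      (forall i, bounded_family e w (D r) (U i)).

Definition connected_in (T : finType) (e : rel T) (A : {set T}) : Prop :=
  forall x y, x \in A -> y \in A ->
    exists s, walk e x y s && all (fun z => z \in A) s.

Definition is_minor (S T : finType) (eH : rel S) (e : rel T) : Prop :=
  exists B : S -> {set T},
    (forall u, B u != finset.set0) /\
    (forall u v, u != v -> [disjoint B u & B v]) /\
    (forall u, connected_in e (B u)) /\
    (forall u v, eH u v -> exists x y, [/\ x \in B u, y \in B v & e x y]).

Definition Kbip (m n : nat) : rel ('I_m + 'I_n)%type :=
  fun u v => match u, v with
             | inl _, inr _ | inr _, inl _ => true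
             | _, _ => false
             end.
Arguments Kbip m n : clear implicits.

(* Main.v *)
Require Import Defs.
From HB Require Import structures.
From mathcomp Require Import all_boot all_order all_algebra.
From mathcomp Require Import boolp classical_sets reals ereal Rstruct.
From mathcomp Require Import zify ring lra.
Import Order.TTheory GRing.Theory Num.Theory.

(** Fix [r]; edges heavier than [2r] are irrelevant at scale [r], and rescaling
    and rounding makes the weights natural numbers.  Let [f] be the distance to
    a base point and, inside a slightly thickened layer [a <= f <= a + 3s], let
    [g] be the intrinsic distance to a base point of the layer.

    Suppose an [s]-chain has [f] within the layer, [b <= g <= b + 2s], and large
    diameter.  Pick [p] points [z_j] of it far apart from each other.  Shortest
    paths from the [z_j] towards the base point of [g] stay disjoint for a while,
    and each has, in its middle, a short path towards the base point of [f].
    These tripods are the [p] vertices of degree 3 of a [K_{3,p}] minor, whose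
    other vertices are a connected part of [{g >= b - s}] containing the chain,
    the ball [{g < b - 20s}] of the layer, and the ball [{f < a - s}].  Hence
    such chains have diameter at most [72ps].

    Cut the values of [f] into bands of width [r] and blocks of three bands, and
    the values of [g] in each block into bands of width [s].  A point gets colour
    [i] if neither band is congruent to [i] modulo 3, so some colour always
    remains.  A monochromatic [r]-component meets at most two consecutive blocks.
    Taking [s = r] in even blocks and [s = 72pr + 2r] in odd ones, its pieces in
    the even block are too small to join distinct [s]-components of the odd one,
    which bounds it by a multiple of [p^2 r]. *)

Set Implicit Arguments.
Unset Strict Implicit.
Unset Printing Implicit Defensive.

(** * Natural-number weights: walks, bounded distance, connectivity inside a region *)

Definition induced (T : finType) (e : rel T) (S : pred T) : rel T :=
  fun x y => [&& e x y, S x & S y].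

Definition nat_weighted (T : finType) (e : rel T) (w : T -> T -> nat) : Prop :=
  symmetric e /\ forall x y, e x y -> 0 < w x y /\ w x y = w y x.

Fixpoint nat_weight (T : Type) (w : T -> T -> nat) (x : T) (s : seq T) : nat :=
  if s is y :: s' then w x y + nat_weight w y s' else 0.

Definition dist_le (T : finType) (e : rel T) (w : T -> T -> nat) (n : nat)
    (x y : T) : Prop :=
  exists2 s, walk e x y s & nat_weight w x s <= n.

(* [f] is the distance to the set of base points, [root x] being the base
   point of the component of [x]. *)
Record potential (T : finType) (e : rel T) (w : T -> T -> nat)
    (f : T -> nat) (root : T -> T) : Prop := Potential {
  pot_root : forall x y, e x y -> root x = root y;
  pot_lip : forall x y, e x y -> f y <= f x + w x y;
  pot_parent : forall x, (root x = x /\ f x = 0) \/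
                 exists2 y, e x y & f x = f y + w x y
}.

Lemma connect_inv (T : finType) (N : rel T) (I : T -> Prop) (x y : T) :
  I x -> (forall u v, I u -> N u v -> I v) -> connect N x y -> I y.
Proof.
move=> Ix HI /connectP[s]; elim: s x Ix => [|z s IH] x Ix /=; first by move=> _ ->.
by case/andP=> xz; apply: IH; apply: HI xz.
Qed.

Lemma connect_invariant_restrict (T : finType) (N : rel T) (F : T -> nat) x y :
  (forall u v, N u v -> F u = F v) -> connect N x y ->
  F y = F x /\ connect (induced N (fun z => F z == F x)) x y.
Proof.
move=> NF; apply: (@connect_inv _ _ (fun y => _ /\ _)) => // u v [Fu xu] uv.
have Fv : F v = F x by rewrite -(NF _ _ uv).
split=> //; apply: connect_trans xu (connect1 _).
by rewrite /induced uv Fu Fv !eqxx.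
Qed.

Lemma induced_connectS (T : finType) (e e' : rel T) (S S' : pred T) x y :
  (forall u v, e u v -> S u -> S v -> induced e' S' u v) ->
  connect (induced e S) x y -> connect (induced e' S') x y.
Proof.
move=> ee'; apply: connect_sub => u v /and3P[uv Su Sv].
by apply: connect1; apply: ee'.
Qed.

Lemma induced_sym (T : finType) (e : rel T) (S : pred T) :
  symmetric e -> symmetric (induced e S).
Proof. by move=> es x y; rewrite /induced es [S x && S y]andbC. Qed.

Lemma induced_connect_in (T : finType) (e : rel T) (S : pred T) x y :
  S x -> connect (induced e S) x y -> S y.
Proof. by move=> Sx; apply: (@connect_inv _ _ (fun z => S z)) => // u v _ /and3P[]. Qed.

Lemma induced_weighted (T : finType) (e : rel T) w (S : pred T) :
  nat_weighted e w -> nat_weighted (induced e S) w.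
Proof. by case=> es ew; split=> [|x y /and3P[/ew]] //; apply: induced_sym. Qed.

Lemma dist_le_refl (T : finType) (e : rel T) w n x : dist_le e w n x x.
Proof. by exists [::]; rewrite /walk /= ?eqxx. Qed.

Lemma dist_le_le (T : finType) (e : rel T) w m n x y :
  m <= n -> dist_le e w m x y -> dist_le e w n x y.
Proof. by move=> mn [s ws le]; exists s => //; apply: leq_trans mn. Qed.

Lemma dist_le_edge (T : finType) (e : rel T) w x y : e x y -> dist_le e w (w x y) x y.
Proof. by move=> xy; exists [:: y]; rewrite /walk /= ?xy ?eqxx ?addn0. Qed.

Lemma dist_le_trans (T : finType) (e : rel T) w m n x y z :
  dist_le e w m x y -> dist_le e w n y z -> dist_le e w (m + n) x z.
Proof.
case=> s /andP[ps /eqP ls] les [t /andP[pt lt] let_].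
exists (s ++ t); first by rewrite /walk cat_path last_cat ls ps pt.
have -> : nat_weight w x (s ++ t) = nat_weight w x s + nat_weight w (last x s) t.
  by elim: s x {ps ls les} => //= a s IH x; rewrite IH addnA.
by rewrite ls leq_add.
Qed.

Lemma dist_le_sym (T : finType) (e : rel T) w n x y :
  nat_weighted e w -> dist_le e w n x y -> dist_le e w n y x.
Proof.
case=> es ew [s /andP[ps /eqP <-]] /dist_le_le; apply.
elim: s x ps => [|z s IH] x /=; first by move=> _; apply: dist_le_refl.
case/andP=> xz /IH nz; rewrite addnC; apply: dist_le_trans nz _.
by rewrite (proj2 (ew _ _ xz)); apply: dist_le_edge; rewrite es.
Qed.

Lemma dist_le_sub (T : finType) (e e' : rel T) w n x y :
  subrel e e' -> dist_le e w n x y -> dist_le e' w n x y.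
Proof.
move=> ee' [s /andP[ps ls] les]; exists s => //.
by rewrite /walk ls (sub_path ee' ps).
Qed.

(* [I m z] is meant as a property of the points [z] reached after length [m]. *)
Lemma dist_le_connect (T : finType) (e : rel T) w (n : nat) (I : nat -> T -> Prop)
    (S : pred T) x y :
  I 0 x ->
  (forall m u v, I m u -> e u v -> m + w u v <= n -> I (m + w u v) v) ->
  (forall m z, m <= n -> I m z -> S z) ->
  dist_le e w n x y ->
  connect (induced e S) x y /\ exists2 m, m <= n & I m y.
Proof.
move=> I0 HI IS [s /andP[ps /eqP <-]].
rewrite -[nat_weight w x s]add0n; move: {1 2}0 I0 => m.
elim: s x m ps => [|z s IH] x m /=.
  by move=> _ Im; rewrite addn0 => mn; split=> //; exists m.
case/andP=> xz ps Im; rewrite addnA => le.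
have Iz : I (m + w x z) z by apply: HI => //; lia.
have [cz ?] := IH _ _ ps Iz le; split=> //.
apply: connect_trans cz; apply: connect1; rewrite /induced xz /=.
by rewrite (IS m) ?(IS (m + w x z)) //; lia.
Qed.

Lemma lipschitz_dist_le (T : finType) (e : rel T) w (h : T -> nat) n x y :
  nat_weighted e w -> (forall u v, e u v -> h v <= h u + w u v) ->
  dist_le e w n x y -> h x <= h y + n /\ h y <= h x + n.
Proof.
move=> ew hl /(@dist_le_connect _ _ _ _
  (fun m z => h x <= h z + m /\ h z <= h x + m) predT) [] //; first by lia.
  move=> m u v [ux xu] uv _; have := hl _ _ uv.
  have := ew.2 _ _ uv; have := hl v u; rewrite ew.1 uv => /(_ isT); lia.
by move=> _ [m mn []]; lia.
Qed.

(** * Shortest-path potentials and descent along parents *)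

Lemma exists_potential (T : finType) (e : rel T) w x0 :
  nat_weighted e w -> exists f root, potential e w f root /\ root x0 = x0.
Proof.
move=> [es ew]; have cs := sym_connect_sym es.
(* The component of [x0] gets [x0] itself as base point, so that a potential can measure the
   distance from a prescribed point. *)
pose rt x := if connect e x0 x then x0 else fingraph.root e x.
have rtP x : connect e x (rt x).
  by rewrite /rt; case: ifP => [|_]; [rewrite cs | apply: connect_root].
have ex x : exists n, `[< dist_le e w n x (rt x) >].
  have /connectP[s ps ls] := rtP x.
  by exists (nat_weight w x s); apply/asboolP; exists s; rewrite // /walk ps -ls /=.
pose f x := ex_minn (ex x).
have fP x : dist_le e w (f x) x (rt x).
  by rewrite /f; case: ex_minnP => n /asboolP.
have fmin n x : dist_le e w n x (rt x) -> f x <= n.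
  by move=> nx; rewrite /f; case: ex_minnP => k _; apply; apply/asboolP.
have rtE x y : e x y -> rt x = rt y.
  move=> xy; rewrite /rt (same_connect_r cs (connect1 xy)).
  by case: ifP => // _; apply/fingraph.rootP => //; apply: connect1.
have lip x y : e x y -> f y <= f x + w x y.
  move=> xy; apply: fmin; rewrite -(rtE _ _ xy) (proj2 (ew _ _ xy)) addnC.
  by apply: dist_le_trans (fP x); apply: dist_le_edge; rewrite es.
exists f, rt; split; last by rewrite /rt connect0.
split=> // x; have [[|y s]] := fP x.
  case/andP=> _ /eqP /= rx _; left; split=> //.
  by have := fmin 0 x; rewrite -rx => /(_ (dist_le_refl _ _ _ _)); case: (f x).
case/andP=> /= /andP[xy ps] ls le; right; exists y => //.
have : f y <= nat_weight w y s.
  by apply: fmin; rewrite -(rtE _ _ xy); exists s; rewrite // /walk ps.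
have := lip y x; rewrite es xy => /(_ isT); have [_ wE] := ew _ _ xy; lia.
Qed.

(** Parents strictly lower [f], because weights are positive, so following them from [x] must cross
    the threshold [t]; [u v] is the crossing edge. The invariant [I] is carried only while [f] stays
    at least [t], hence up to [u] but not to [v]. *)
Lemma descend (T : finType) (e : rel T) w f rt (I S : T -> bool) (t : nat) x :
  nat_weighted e w -> potential e w f rt -> 0 < t -> t <= f x -> I x ->
  (forall u v, I u -> t <= f v -> e u v -> f u = f v + w u v -> I v) ->
  (forall z, I z -> t <= f z -> S z) ->
  exists u v, [/\ connect (induced e S) x u, I u & t <= f u] /\
              [/\ e u v, f v < t & f u = f v + w u v].
Proof.
move=> [es ew] pot t0 tx Ix HI IS.
have [n] := ubnP (f x); elim: n x tx Ix => // n IH x tx Ix fx.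
case: (pot_parent pot x) => [[_ f0]|[y xy fE]]; first by lia.
have [w0 _] := ew _ _ xy.
case: (ltnP (f y) t) => ty; first by exists x, y; rewrite connect0.
have Iy : I y by apply: HI xy fE.
have [|u [v [[cu Iu tu] st]]] := IH y ty Iy; first lia.
exists u, v; split=> //; split=> //; apply: connect_trans cu; apply: connect1.
by rewrite /induced xy !IS.
Qed.

Lemma connect_root_ball (T : finType) (e : rel T) w f rt (S : pred T) x :
  nat_weighted e w -> potential e w f rt -> (forall z, f z <= f x -> S z) ->
  [/\ connect (induced e S) x (rt x), dist_le e w (f x) x (rt x) & f (rt x) = 0].
Proof.
move=> [es ew] pot; have [n] := ubnP (f x); elim: n x => // n IH x fx HS.
case: (pot_parent pot x) => [[-> ->]|[y xy fE]].
  by split=> //; exact: dist_le_refl.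
have [w0 _] := ew _ _ xy; have [||c nr f0] := IH y; first lia.
  by move=> z zy; apply: HS; lia.
rewrite (pot_root pot xy); split=> //.
  by apply: connect_trans c; apply: connect1; rewrite /induced xy !HS //; lia.
by rewrite fE addnC; apply: dist_le_trans nr; apply: dist_le_edge.
Qed.

(** A discrete intermediate value theorem: a chain whose steps raise [h] by at most [s] cannot jump
    over a window of width [s]. *)
Lemma connect_ivt (T : finType) (N : rel T) (h : T -> nat) s t x y :
  (forall u v, N u v -> h v <= h u + s) -> connect N x y -> h x <= t <= h y ->
  exists2 z, connect N x z & t <= h z <= t + s.
Proof.
move=> Nh xy /andP[hx hy].
pose I v := connect N x v /\
    (h v <= t \/ exists2 z, connect N x z & t <= h z <= t + s).
have [_ [le|//]] : I y.
  move: xy; apply: connect_inv; first by split; [apply: connect0 | left].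
  move=> u v [xu [le|ex]] uv; have xv := connect_trans xu (connect1 uv).
    split=> //; case: (leqP (h v) t) => [|lt]; first by left.
    by right; exists v => //; have := Nh _ _ uv; lia.
  by split=> //; right.
by exists y => //; lia.
Qed.

Lemma pot_lip2 (T : finType) (e : rel T) w f rt u v :
  nat_weighted e w -> potential e w f rt -> e u v ->
  f v <= f u + w u v /\ f u <= f v + w u v.
Proof.
move=> [es ew] pot uv; split; first exact: (pot_lip pot).
by rewrite (ew _ _ uv).2; apply: (pot_lip pot); rewrite es.
Qed.

Lemma pot_root_connect (T : finType) (e : rel T) w f rt (S : pred T) x y :
  potential e w f rt -> connect (induced e S) x y -> rt y = rt x.
Proof.
move=> pot; apply: (@connect_inv _ _ (fun y => rt y = rt x)) => // u v ru.
by case/and3P=> /(pot_root pot) <-.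
Qed.

(** * A [K_{3,p}] minor from a long chain in a thin layer *)

(** The branch set of [k] is the component of [b k] inside [S k]; it is connected by construction,
    so only disjointness of the regions and the adjacencies remain to be checked. *)
Lemma minor_of_regions (K T : finType) (eK : rel K) (e : rel T)
    (S : K -> pred T) (b : K -> T) :
  symmetric e -> (forall k, S k (b k)) ->
  (forall k l z, S k z -> S l z -> k = l) ->
  (forall k l, eK k l -> exists u v,
    [/\ connect (induced e (S k)) (b k) u, connect (induced e (S l)) (b l) v
      & e u v]) ->
  is_minor eK e.
Proof.
move=> es Sb disj adj.
exists (fun k => [set z | connect (induced e (S k)) (b k) z]); split; last split.
- by move=> k; apply/set0Pn; exists (b k); rewrite inE.
- move=> k l kl; rewrite -setI_eq0; apply/eqP/setP=> z; rewrite !inE.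
  apply/negP=> /andP[/(induced_connect_in (Sb k)) zk].
  by move/(induced_connect_in (Sb l)) => zl; rewrite (disj k l z) ?eqxx in kl.
split=> [k x y|k l /adj[u [v [ku lv uv]]]]; last by exists u, v; rewrite !inE.
rewrite !inE => bx by_.
have cs : connect_sym (induced e (S k)) by apply/sym_connect_sym/induced_sym.
have : connect (induced e (S k)) x y by apply: connect_trans by_; rewrite cs.
case/connectP=> t pt ->; exists t; rewrite /walk eqxx andbT.
rewrite (sub_path _ pt) /=; last by move=> u v /and3P[].
apply/allP=> z zt; rewrite inE; apply: connect_trans bx _.
by apply: (path_connect pt); rewrite inE zt orbT.
Qed.

(* [lia] restricted to the hypotheses it can use: it is very slow in the
   presence of many boolean ones. *)
Ltac nat_lia :=
  repeat match goal with
  | H : is_true (leq _ _) |- _ => revert H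
  | H : @eq nat _ _ |- _ => revert H
  end;
  repeat match goal with H : _ |- _ => clear H end;
  intros; lia.

(* The path from [z] towards the base point of [g] crosses [SM] and enters
   [SB']; from its middle, a path towards the base point of [f] leaves [SM]
   into [SB]. *)
Lemma three_arms (T : finType) (e : rel T) w f rt g sg h rh (A : pred T)
    (a b s : nat) x z :
  let SP v := A v && (b <= g v + s) in
  let SB v := f v + s < a in
  let SB' v := A v && (g v + 20 * s < b) in
  let SM v := [&& A v, g v + s < b, b <= g v + 20 * s,
                  h v <= h z + 35 * s & h z <= h v + 35 * s] in
  nat_weighted e w -> (forall u v, e u v -> w u v <= s) -> 0 < s ->
  (forall v, A v = (a <= f v + s) && (f v <= a + 4 * s)) ->
  potential e w f rt -> potential (induced e A) w g sg -> potential e w h rh ->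
  s < a -> 20 * s < b ->
  A z -> b <= g z -> g z <= b + 2 * s -> sg z = sg x ->
  connect (induced e SP) x z ->
  exists c, SM c /\
   [/\ exists u v, [/\ connect (induced e SB) (rt x) u,
                      connect (induced e SM) c v & e u v],
      exists u v, [/\ connect (induced e SB') (sg x) u,
                      connect (induced e SM) c v & e u v] &
      exists u v, [/\ connect (induced e SP) x u,
                      connect (induced e SM) c v & e u v]].
Proof.
move=> SP SB SB' SM ew ws s0 AE potf potg poth as_ bs Az gz1 gz2 sgz cz.
have eAw : nat_weighted (induced e A) w := induced_weighted A ew.
have rz := pot_root_connect potf cz.
have [b' bE] : exists b', b = b' + 20 * s by exists (b - 20 * s); rewrite subnK // ltnW.
have [a' aE] : exists a', a = a' + s by exists (a - s); rewrite subnK // ltnW.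
have SMsub u v : induced e A u v -> SM u -> SM v -> induced e SM u v.
  by move=> /and3P[uv _ _] ? ?; apply/and3P.
(* Along parents for [g] the length walked equals the drop of [g], so the Lipschitz function [h]
   moves by at most that drop. The last two conjuncts say this without subtraction. *)
pose I1 v := [&& A v, g v <= g z, h v + g v <= h z + g z
               & h z + g v <= h v + g z].
have [|||u v /and4P[? ? ? ?] ? uv ?|v /and4P[? ? ? ?] ?|
      u1 [v1 [[cu1 /and4P[? ? ? ?] ?] [uv1 ? ?]]]] :=
  @descend _ _ w g sg I1 SP (b' + 19 * s) z eAw potg.
- by nat_lia.
- by nat_lia.
- by rewrite /I1 Az /=; nat_lia.
- have /and3P[uve _ Av] := uv; have [? ?] := pot_lip2 ew poth uve.
  by apply/and4P; split=> //; nat_lia.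
- by apply/andP; split=> //; nat_lia.
have /and3P[uve1 _ Av1] := uv1; have [? ?] := pot_lip2 ew poth uve1.
have wv1 := ws _ _ uve1.
have SM1 : SM v1 by apply/and5P; split=> //; nat_lia.
have sg1 : sg v1 = sg x.
  by rewrite -(pot_root potg uv1) (pot_root_connect potg cu1) sgz.
pose I2 v := [&& A v, g v <= g v1, h v + g v <= h v1 + g v1
               & h v1 + g v <= h v + g v1].
have I2step u v : I2 u -> induced e A u v -> g u = g v + w u v -> I2 v.
  move=> /and4P[? ? ? ?] /and3P[uv _ Av] ?; have [? ?] := pot_lip2 ew poth uv.
  by apply/and4P; split=> //; nat_lia.
have I2SM v : I2 v -> b' <= g v -> SM v.
  by move=> /and4P[? ? ? ?] ?; apply/and5P; split=> //; nat_lia.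
have I21 : I2 v1 by rewrite /I2 Av1 /=; nat_lia.
exists v1; split=> //; split.
(* The arm towards the base point of [f] starts halfway, at [g] about [b' + 10 * s]. Until [f] falls
   below [a - s] it drops by at most [5 * s], so [g] stays between [b' + 4 * s] and [b' + 15 * s],
   inside [SM]. *)
- have [|||||u3 [v3 [[cu3 I3 ?] [uv3 ? ?]]]] :=
    @descend _ _ w g sg I2 SM (b' + 10 * s) v1 eAw potg.
  + by nat_lia.
  + by nat_lia.
  + by [].
  + by move=> u v Iu _; apply: I2step.
  + by move=> v Iv ?; apply: I2SM => //; nat_lia.
  have wv3 : w u3 v3 <= s by apply: ws; case/and3P: uv3.
  have I3' : I2 v3 by apply: I2step uv3 _.
  have SM3 : SM v3 by apply: I2SM => //; nat_lia.
  have cv3 : connect (induced e SM) v1 v3.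
    apply: connect_trans (induced_connectS SMsub cu3) (connect1 _).
    by apply: SMsub => //; apply: I2SM => //; nat_lia.
  have /and4P[Av3 ? ? ?] := I3'; have /andP[? ?] : (a <= f v3 + s) && (f v3 <= a + 4 * s) by rewrite -AE.
  (* [g] is Lipschitz only along edges of the layer, so [A] belongs to the invariant; it persists
     since [f] stays between [a - s] and [f v3]. *)
  pose I4 v := [&& A v, f v <= f v3, g v + f v <= g v3 + f v3,
                 g v3 + f v <= g v + f v3
               & (h v + f v <= h v3 + f v3) && (h v3 + f v <= h v + f v3)].
  have [|||u v /and5P[Au ? ? ? /andP[? ?]] ? uv ?|v /and5P[Av ? ? ? /andP[? ?]] ?|
        u4 [v4 [[cu4 _ ?] [uv4 ? ?]]]] :=
    @descend _ e w f rt I4 SM a' v3 ew potf.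
  + by nat_lia.
  + by nat_lia.
  + by rewrite /I4 Av3 /=; nat_lia.
  + have Av : A v by rewrite AE; nat_lia.
    have uvA : induced e A u v by apply/and3P.
    have [? ?] := pot_lip2 ew poth uv; have [? ?] := pot_lip2 eAw potg uvA.
    by rewrite /I4 Av /=; nat_lia.
  + by apply/and5P; split=> //; nat_lia.
  exists v4, u4; split; last by rewrite ew.1.
    have [|c _ _] := @connect_root_ball _ e w f rt SB v4 ew potf.
      by move=> v; rewrite /SB; nat_lia.
    rewrite (sym_connect_sym (induced_sym _ ew.1)); move: c.
    rewrite -(pot_root potf uv4) (pot_root_connect potf cu4).
    rewrite (pot_root_connect potf cv3) -(pot_root potf uve1).
    have c1 : connect (induced e SP) z u1.
      by apply: induced_connectS cu1 => u v /and3P[uv _ _] ? ?; apply/and3P.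
    by rewrite (pot_root_connect potf c1) rz.
  by apply: connect_trans cv3 cu4.
(* The path of [g] continues down to [b' = b - 20 * s]. The total drop from [z] inside [SM] is at
   most [22 * s], below the [35 * s] that [SM] allows to [h]. *)
- have [|||||u2 [v2 [[cu2 _ ?] [uv2 ? ?]]]] :=
    @descend _ _ w g sg I2 SM b' v1 eAw potg.
  + by nat_lia.
  + by nat_lia.
  + by [].
  + by move=> u v Iu _; apply: I2step.
  + by move=> v Iv ?; apply: I2SM => //; nat_lia.
  exists v2, u2; split; [|exact: induced_connectS SMsub cu2|by case/and3P: uv2; rewrite ew.1].
  have [|c _ _] := @connect_root_ball _ _ w g sg (fun v => g v + 20 * s < b) v2 eAw potg.
    by move=> v; nat_lia.
  rewrite (sym_connect_sym (induced_sym _ ew.1)) -sg1.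
  rewrite -(pot_root_connect potg cu2) (pot_root potg uv2).
  apply: induced_connectS c => u v /and3P[uv Au Av] ? ?.
  by apply/and3P; split=> //; apply/andP.
exists u1, v1; split=> //; apply: connect_trans cz _.
by apply: induced_connectS cu1 => u v /and3P[uv _ _] ? ?; apply/and3P.
Qed.

(** A walk of length at most [s] from the inner layer stays in the thickened one, so the intrinsic
    potential [g] is Lipschitz along it. *)
Lemma layer_step (T : finType) (e : rel T) w f rt g sg (a s : nat) (A : pred T) u v :
  nat_weighted e w -> (forall z, A z = (a <= f z + s) && (f z <= a + 4 * s)) ->
  potential e w f rt -> potential (induced e A) w g sg ->
  a <= f u -> f u <= a + 3 * s -> dist_le e w s u v ->
  [/\ connect (induced e (fun z => A z && (g u <= g z + s))) u v,
      sg v = sg u, g v <= g u + s & g u <= g v + s].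
Proof.
move=> ew AE potf potg fu1 fu2 nuv.
have eAw : nat_weighted (induced e A) w := induced_weighted A ew.
pose I m z := [/\ f z <= f u + m, f u <= f z + m, g z <= g u + m,
                g u <= g z + m & sg z = sg u].
have [|m u' v' [? ? ? ? ?] uv' le|m z ms [? ? ? ? ?]|c [m ? [? ? ? ? ?]]] :=
  @dist_le_connect _ e w s I (fun z => A z && (g u <= g z + s)) u v _ _ _ nuv.
- by split=> //; rewrite addn0.
- have [? ?] := pot_lip2 ew potf uv'.
  have uvA : induced e A u' v' by rewrite /induced uv' !AE; nat_lia.
  have [? ?] := pot_lip2 eAw potg uvA.
  by split; try nat_lia; rewrite -(pot_root potg uvA).
- by rewrite AE; nat_lia.
by split=> //; nat_lia.
Qed.

Lemma layer_chain_bound (T : finType) (e : rel T) w f rt g sg (a b s p : nat)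
    (X : pred T) (N : rel T) x y :
  let A z := (a <= f z + s) && (f z <= a + 4 * s) in
  nat_weighted e w -> (forall u v, e u v -> w u v <= s) -> 0 < s -> 0 < p ->
  potential e w f rt -> potential (induced e A) w g sg ->
  (forall z, X z -> [&& a <= f z, f z <= a + 3 * s, b <= g z & g z <= b + 2 * s]) ->
  (forall u v, N u v -> [/\ X u, X v & dist_le e w s u v]) ->
  ~ is_minor (Kbip 3 p) e ->
  X x -> connect N x y -> dist_le e w (72 * p * s) x y.
Proof.
move=> A ew ws s0 p0 potf potg XP NP nomin Xx xy.
have eAw : nat_weighted (induced e A) w := induced_weighted A ew.
pose SP z := A z && (b <= g z + s).
have stepP u v : N u v -> connect (induced e SP) u v /\ sg v = sg u.
  move=> uv; have [Xu Xv nuv] := NP u v uv.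
  have := XP u Xu; have := XP v Xv => /and4P[? ? ? ?] /and4P[? ? ? ?].
  have [||||c -> _ _] := @layer_step _ e w f rt g sg a s A u v ew _ potf potg => //.
  split=> //; apply: induced_connectS c => u' v' uv' /andP[? ?] /andP[? ?].
  by apply/and3P; split=> //; apply/andP; split=> //; nat_lia.
have chainP z : connect N x z -> [/\ X z, connect (induced e SP) x z & sg z = sg x].
  apply: (@connect_inv _ _ (fun z => [/\ _, _ & _])) => // u v [Xu cu su] uv.
  have [_ Xv _] := NP u v uv; have [cuv sv] := stepP u v uv.
  by split=> //; [apply: connect_trans cuv | rewrite sv].
have [Xy cxy sgy] := chainP y xy.
have := XP x Xx; have := XP y Xy => /and4P[fy1 fy2 gy1 gy2] /and4P[fx1 fx2 gx1 gx2].
have rty : rt y = rt x := pot_root_connect potf cxy.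
(* Here the ball below the layer would be empty, but [x] and [y] lie within [4 * s] of their common
   base point. *)
case: (leqP a s) => as_.
  have [_ nx _] := @connect_root_ball _ e w f rt predT x ew potf (fun _ _ => isT).
  have [_ ny _] := @connect_root_ball _ e w f rt predT y ew potf (fun _ _ => isT).
  rewrite rty in ny; have := dist_le_trans nx (dist_le_sym ew ny).
  by apply: dist_le_le; nia.
(* Likewise for [g]: both points lie within [22 * s] of the same base point of the layer. *)
case: (leqP b (20 * s)) => bs.
  have [_ nx _] := @connect_root_ball _ _ w g sg predT x eAw potg (fun _ _ => isT).
  have [_ ny _] := @connect_root_ball _ _ w g sg predT y eAw potg (fun _ _ => isT).
  rewrite sgy in ny; have nxy := dist_le_trans nx (dist_le_sym eAw ny).
  apply: dist_le_le (dist_le_sub (e' := e) _ nxy); first by nia.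
  by move=> u v /and3P[].
have [h [rh [poth rhx]]] := exists_potential x ew.
have [_ nyx _] := @connect_root_ball _ e w h rh predT y ew poth (fun _ _ => isT).
have [_ _ hx0] := @connect_root_ball _ e w h rh predT x ew poth (fun _ _ => isT).
rewrite rhx in hx0; rewrite (pot_root_connect poth cxy) rhx in nyx.
case: (leqP (h y) (72 * p * s)) => [hy|hy].
  by apply: dist_le_le hy _; apply: dist_le_sym.
case: nomin.
(* With [h] the distance from [x], the chain passes all heights [72 * j * s]. Consecutive windows of
   radius [35 * s] around the [h (z j)] are disjoint, as [2 * 35 + 1 < 72]. *)
have zP (j : 'I_p) : exists z, connect N x z /\ (72 * j * s <= h z <= 72 * j * s + s).
  have [||z] := @connect_ivt _ N h s (72 * j * s) x y _ xy; last by exists z.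
  - by move=> u v /NP[_ _ /(lipschitz_dist_le ew (pot_lip poth))[]].
  - by rewrite hx0 /=; have := ltn_ord j; nia.
have [z {}zP] := fin_all_exists zP.
pose SM (j : 'I_p) v := [&& A v, g v + s < b, b <= g v + 20 * s,
                    h v <= h (z j) + 35 * s & h (z j) <= h v + 35 * s].
pose SB v := f v + s < a.
pose SB' v := A v && (g v + 20 * s < b).
have armP (j : 'I_p) : exists c, SM j c /\
   [/\ exists u v, [/\ connect (induced e SB) (rt x) u,
                      connect (induced e (SM j)) c v & e u v],
      exists u v, [/\ connect (induced e SB') (sg x) u,
                      connect (induced e (SM j)) c v & e u v] &
      exists u v, [/\ connect (induced e SP) x u,
                      connect (induced e (SM j)) c v & e u v]].
  have [xz hz] := zP j; have [Xz cz sgz] := chainP _ xz.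
  have /and4P[fz1 fz2 gz1 gz2] := XP _ Xz.
  apply: (@three_arms _ e w f rt g sg h rh A) => //; last by rewrite /A; lia.
have [c {}armP] := fin_all_exists armP.
(* [SB] lies below the layer; inside it, increasing values of [g] separate [SB'], the tripods and
   [SP]. *)
pose S (k : 'I_3 + 'I_p) : pred T :=
  match k with
  | inl i => if i == 0 :> nat then SB else if i == 1 :> nat then SB' else SP
  | inr j => SM j
  end.
pose base (k : 'I_3 + 'I_p) : T :=
  match k with
  | inl i => if i == 0 :> nat then rt x else if i == 1 :> nat then sg x else x
  | inr j => c j
  end.
have arm i j : exists u v, [/\ connect (induced e (S (inl i))) (base (inl i)) u,
    connect (induced e (SM j)) (c j) v & e u v].
  rewrite /S /base; have [_ [? ? ?]] := armP j.
  by case: eqP => // _; case: eqP.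
apply: (@minor_of_regions _ _ _ e S base) => //; first exact: ew.1.
- case=> [i|j]; last by have [] := armP j.
  rewrite /S /base; case: eqP => _; last case: eqP => _.
  + have [_ _ f0] := @connect_root_ball _ e w f rt predT x ew potf (fun _ _ => isT).
    by rewrite /SB f0; lia.
  + have [c0 _ g0] := @connect_root_ball _ _ w g sg predT x eAw potg (fun _ _ => isT).
    rewrite /SB' g0; apply/andP; split; last by lia.
    have : connect (induced e A) x (sg x).
      by apply: induced_connectS c0 => u v.
    by apply: induced_connect_in; rewrite /A; lia.
  + by rewrite /SP /A; lia.
- have SMP v j : S (inr j) v -> A v /\ (g v + s < b <= g v + 20 * s) by case/and5P=> -> -> ->.
  have SMneq i j v : S (inl i) v -> S (inr j) v -> False.
    move=> Si /SMP[]; move: Si; rewrite /S /SB /SB' /SP /A.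
    by case: eqP => _; [|case: eqP => _]; lia.
  move=> [i|j] [i'|j'] v Sk Sl.
  + congr inl; apply: val_inj; move: Sk Sl (ltn_ord i) (ltn_ord i').
    rewrite /S /SB /SB' /SP /A /=.
    by do 2![case: eqP => ?; [|case: eqP => ?]]; lia.
  + by case: (SMneq _ _ _ Sk Sl).
  + by case: (SMneq _ _ _ Sl Sk).
  + congr inr; apply: val_inj => /=.
    have [_ hj] := zP j; have [_ hj'] := zP j'.
    move: Sk Sl => /and5P[_ _ _ ? ?] /and5P[_ _ _ ? ?].
    have lt (i i' : nat) : i < i' -> 72 * i * s + 72 * s <= 72 * i' * s.
      by move=> ?; nia.
    by case: (ltngtP j j') => // /lt; lia.
- move=> [i|j] [i'|j'] //= _; first exact: arm.
  by have [u [v [cu cv uv]]] := arm i' j; exists v, u; rewrite ew.1.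
Qed.

(** * Colouring by bands modulo 3 *)

(** Dropping the bands congruent to [i] leaves pairs of adjacent bands, numbered by
    [(q + 2 - i) %/ 3]. A step of length at most [s] cannot jump over a dropped band. *)
Lemma band_eq (s i m n : nat) :
  0 < s -> i < 3 -> (m %/ s) %% 3 != i -> (n %/ s) %% 3 != i ->
  m <= n + s -> n <= m + s ->
  (m %/ s + 2 - i) %/ 3 = (n %/ s + 2 - i) %/ 3.
Proof.
move=> s0 i3 mi ni mn nm.
have := leq_div2r s mn; have := leq_div2r s nm; rewrite !divnDr // divnn s0.
move: (m %/ s) (n %/ s) mi ni => a b.
by case: i i3 => [|[|[|//]]] _; lia.
Qed.

(** A pair of bands has width [2 * s]. The subtraction of 2 truncates only in the lowest group,
    where the lower end is 0. *)
Lemma band_bounds (s i m : nat) :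
  0 < s -> i < 3 -> (m %/ s) %% 3 != i ->
  ((3 * ((m %/ s + 2 - i) %/ 3) + i - 2) * s <= m) &&
  (m <= (3 * ((m %/ s + 2 - i) %/ 3) + i - 2) * s + 2 * s).
Proof.
move=> s0 i3 mi; set c := 3 * _ + i - 2; have := divn_eq m s; have := ltn_pmod m s0.
have : (c <= m %/ s) && (m %/ s <= c.+1).
  rewrite /c; move: (m %/ s) mi {c} => q.
  by case: i i3 => [|[|[|//]]] _; lia.
by move: (m %/ s) (m %% s) c => q t c /andP[? ?] ? ?; apply/andP; split; nia.
Qed.

(** By [band_eq] a chain keeps to one pair of bands of [g], which is the situation of
    [layer_chain_bound]. *)
Lemma layer_color_bound (T : finType) (e : rel T) w f rt g sg (a s p i : nat)
    (X : pred T) (N : rel T) x y :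
  let A z := (a <= f z + s) && (f z <= a + 4 * s) in
  nat_weighted e w -> (forall u v, e u v -> w u v <= s) -> 0 < s -> 0 < p ->
  potential e w f rt -> potential (induced e A) w g sg -> i < 3 ->
  (forall z, X z -> [&& a <= f z, f z <= a + 3 * s & (g z %/ s) %% 3 != i]) ->
  (forall u v, N u v -> [/\ X u, X v & dist_le e w s u v]) ->
  ~ is_minor (Kbip 3 p) e ->
  X x -> connect N x y -> dist_le e w (72 * p * s) x y.
Proof.
move=> A ew ws s0 p0 potf potg i3 XP NP nomin Xx xy.
pose F z := (g z %/ s + 2 - i) %/ 3.
have NF u v : N u v -> F u = F v.
  move=> /NP[/XP/and3P[fu1 fu2 gu] /XP/and3P[_ _ gv] nuv].
  have [//|//|//|//|_ _ l1 l2] := @layer_step _ e w f rt g sg a s A u v ew _ potf potg.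
  exact: band_eq.
have [_ {}xy] := connect_invariant_restrict NF xy.
pose X' z := X z && (F z == F x).
apply: (@layer_chain_bound _ e w f rt g sg a ((3 * F x + i - 2) * s) s p X' _ x y
  ew ws s0 p0 potf potg _ _ nomin _ xy); last by rewrite /X' Xx eqxx.
  move=> z /andP[/XP/and3P[-> -> gz] /eqP Fz] /=.
  by rewrite -Fz; apply: band_bounds.
move=> u v /and3P[/NP[? ? ?] ? ?]; split=> //; exact/andP.
Qed.

(** * Combining two scales into a cover with three colours *)

(** An excursion outside [O] has diameter at most [D1], so the points of [O] just before and after
    it are within [D1 + 2 * r] and already joined by [NO]. Thus all points of [O] in the component
    lie in one [NO]-component, and the others within [D1 + r] of it. *)
Lemma two_scale_bound (T : finType) (e : rel T) w (N NO : rel T) (O : pred T)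
    (D1 D2 r : nat) x y :
  nat_weighted e w -> symmetric N -> (forall u v, N u v -> dist_le e w r u v) ->
  (forall u v, ~~ O u -> connect (induced N (predC O)) u v -> dist_le e w D1 u v) ->
  (forall u v, O u -> connect NO u v -> dist_le e w D2 u v) ->
  (forall u v, O u -> O v -> connect N u v -> dist_le e w (D1 + 2 * r) u v ->
     connect NO u v) ->
  connect N x y -> dist_le e w (2 * (D2 + D1 + r)) x y.
Proof.
move=> ew Ns Nr HE HO NOP xy; have cs := sym_connect_sym Ns.
have [/existsP[o /andP[Oo xo]]|noO] := boolP [exists o, O o && connect N x o].
  (* Outside [O] the invariant remembers the last point [u] in [O] and the first point [v] of the
     current excursion. *)
  pose J z := connect N o z /\
    if O z then is_true (connect NO o z)
    else exists u v, [/\ O u, connect NO o u, connect N o u, N u v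
                       & ~~ O v && connect (induced N (predC O)) v z].
  have JP z : connect N o z -> J z.
    apply: connect_inv; first by split; rewrite ?Oo.
    move=> u v [ou Ju] uv; have ov := connect_trans ou (connect1 uv).
    split=> //; case: ifP => Ov; case: ifP Ju => Ou.
    - move=> cu; apply: connect_trans cu _; apply: NOP => //.
        exact: connect1.
      by apply: dist_le_le (Nr _ _ uv); nat_lia.
    - case=> u' [v' [Ou' cu' ou' uv' /andP[Ov' vu]]].
      apply: connect_trans cu' _; apply: NOP => //.
        by apply: connect_trans ov; rewrite cs.
      have := dist_le_trans (Nr _ _ uv') (dist_le_trans (HE _ _ Ov' vu) (Nr _ _ uv)).
      by apply: dist_le_le; nat_lia.
    - by move=> cu; exists u, v; split=> //; rewrite Ov connect0.
    case=> u' [v' [Ou' cu' ou' uv' /andP[Ov' vu]]].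
    exists u', v'; split=> //; rewrite Ov' /=; apply: connect_trans vu (connect1 _).
    by rewrite /induced uv /= Ou Ov.
  have bound z : connect N o z -> dist_le e w (D2 + D1 + r) o z.
    move=> /JP[_]; case: ifP => [_ /(HO _ _ Oo)|_].
      by apply: dist_le_le; nat_lia.
    case=> u [v [Ou cu _ uv /andP[Ov vz]]].
    have := dist_le_trans (HO _ _ Oo cu) (dist_le_trans (Nr _ _ uv) (HE _ _ Ov vz)).
    by apply: dist_le_le; nat_lia.
  rewrite mul2n -addnn; apply: dist_le_trans (bound y _).
    by apply: dist_le_sym => //; apply: bound; rewrite cs.
  by apply: connect_trans xy; rewrite cs.
have nO z : connect N x z -> ~~ O z.
  by move=> xz; apply: contra noO => Oz; apply/existsP; exists z; rewrite Oz.
have [_ xyE] : connect N x y /\ connect (induced N (predC O)) x y.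
  move: xy; apply: (@connect_inv _ _ (fun z => _ /\ _)) => // u v [xu cu] uv.
  have xv := connect_trans xu (connect1 uv); split=> //.
  by apply: connect_trans cu (connect1 _); rewrite /induced uv /= !nO.
by apply: dist_le_le (HE _ _ (nO _ (connect0 _ _)) xyE); lia.
Qed.

Lemma nat_three_cover (T : finType) (e : rel T) w (r p : nat) :
  nat_weighted e w -> (forall u v, e u v -> w u v <= r) -> 0 < r -> 0 < p ->
  ~ is_minor (Kbip 3 p) e ->
  exists X : 'I_3 -> pred T, (forall x, exists i, X i x) /\
    forall i (N : rel T) x y,
      (forall u v, N u v -> [/\ X i u, X i v & dist_le e w r u v]) ->
      symmetric N -> connect N x y ->
      dist_le e w ((105 * p) ^ 2 * r) x y.
Proof.
move=> ew wr r0 p0 nomin.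
have [x0 _|T0] := pickP (@predT T); last first.
  by exists (fun _ => predT); split=> [x|i N x]; have := T0 x.
have [f [rt [potf _]]] := exists_potential x0 ew.
pose blk z := (f z %/ r) %/ 3.
pose sc k := if odd k then 72 * p * r + 2 * r else r.
pose A k z := (3 * k * r <= f z + sc k) && (f z <= 3 * k * r + 4 * sc k).
have rsc k : r <= sc k by rewrite /sc; case: ifP => // _; lia.
have gP k : exists g : (T -> nat) * (T -> T), potential (induced e (A k)) w g.1 g.2.
  have [g [sg [pg _]]] := exists_potential x0 (induced_weighted (A k) ew).
  by exists (g, sg).
have [g {}gP] := choice gP.
pose X (i : 'I_3) z := ((f z %/ r) %% 3 != i) &&
  (((g (blk z)).1 z %/ sc (blk z)) %% 3 != i).
exists X; split=> [x|i N x y NP Ns xy].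
  have ex (m n : nat) : exists i : 'I_3, (m != i) && (n != i).
    case: m => [|[|m]]; case: n => [|[|n]];
      by [exists (@Ordinal 3 0 isT) | exists (@Ordinal 3 1 isT) | exists (@Ordinal 3 2 isT)].
  exact: ex.
have [-> | /eqP neq] := eqVneq x y; first exact: dist_le_refl.
have XN u v : connect N u v -> u <> v -> X i u.
  by case/connectP=> -[_ /= -> //|z s /= /andP[/NP[]]].
have fblk z : 3 * blk z * r <= f z <= 3 * blk z * r + 3 * r.
  have := divn_eq (f z) r; have := ltn_pmod (f z) r0.
  have := divn_eq (f z %/ r) 3; have := @ltn_pmod (f z %/ r) 3 isT.
  by rewrite /blk; nia.
have color (N' : rel T) u v :
    (forall u v, N' u v -> [/\ X i u, X i v, blk u = blk v
                             & dist_le e w (sc (blk u)) u v]) ->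
    X i u -> connect N' u v -> dist_le e w (72 * p * sc (blk u)) u v.
  move=> N'P Xu uv.
  have [|_ {}uv] := @connect_invariant_restrict _ N' blk u v _ uv.
    by move=> ? ? /N'P[].
  apply: (@layer_color_bound _ e w f rt _ _ (3 * blk u * r) (sc (blk u)) p i
    (fun z => X i z && (blk z == blk u)) _ u v ew _ _ p0 potf (gP (blk u)) _
    _ _ nomin _ uv) => //.
  - by move=> a b /wr ab; apply: leq_trans (rsc _).
  - exact: leq_trans r0 (rsc _).
  - move=> z /andP[/andP[_ Xz] /eqP bz]; rewrite -bz Xz andbT.
    by have := fblk z; have := rsc (blk z); lia.
  - by move=> a b /and3P[/N'P[Xa Xb _ ab] /eqP ba /eqP bb]; rewrite Xa Xb ba bb eqxx -ba.
  by rewrite Xu eqxx.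
pose m z := (f z %/ r + 2 - i) %/ 3.
have mN u v : N u v -> m u = m v.
  move=> /NP[/andP[fu _] /andP[fv _] /(lipschitz_dist_le ew (pot_lip potf))[l1 l2]].
  exact: band_eq.
pose O z := odd (blk z).
have scE z : sc (blk z) = if O z then 72 * p * r + 2 * r else r by [].
have mblk u v : X i u -> X i v -> m u = m v -> O u = O v -> blk u = blk v.
  move=> /andP[fu _] /andP[fv _]; rewrite /m /O /blk.
  move: (ltn_ord i) fu fv; move: (f u %/ r) (f v %/ r) (nat_of_ord i) => a b.
  by case=> [|[|[|//]]] _; lia.
pose NO u v := [&& X i u, X i v, O u, O v, m u == m v
                 & `[< dist_le e w (72 * p * r + 2 * r) u v >]].
pose DO := 72 * p * (72 * p * r + 2 * r).
(* The left side is [10368 * p ^ 2 * r + 432 * p * r + 2 * r], at most [10802 * p ^ 2 * r], and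
   [105 ^ 2 = 11025]. *)
have leD : 2 * (DO + 72 * p * r + r) <= (105 * p) ^ 2 * r.
  rewrite /DO -mulnn; have := leq_pmull r p0; have := leq_pmull (p * r) p0.
  by nat_lia.
apply: dist_le_le leD _; apply: (two_scale_bound (N := N) (NO := NO) (O := O)) => //.
- by move=> u v /NP[].
- move=> u v Ou uv; have [-> | /eqP uv'] := eqVneq u v; first exact: dist_le_refl.
  have -> : r = sc (blk u) by rewrite scE (negbTE Ou).
  apply: (color _ _ _ _ _ uv).
    move=> a b /and3P[/[dup] /mN mab /NP[Xa Xb ab] /= Oa Ob]; split=> //.
      by apply: mblk => //; rewrite (negbTE Oa) (negbTE Ob).
    by rewrite scE (negbTE Oa).
  apply: XN uv'; apply: connect_sub uv => a b /and3P[? _ _]; exact: connect1.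
- move=> u v Ou uv; have [-> | /eqP uv'] := eqVneq u v; first exact: dist_le_refl.
  rewrite /DO; have -> : 72 * p * r + 2 * r = sc (blk u) by rewrite scE Ou.
  apply: (color _ _ _ _ _ uv).
    move=> a b /and5P[Xa Xb Oa Ob /andP[/eqP mab /asboolP ab]]; split=> //.
      by apply: mblk => //; rewrite Oa Ob.
    by rewrite scE Oa.
  by case/connectP: uv uv' => -[_ /= -> //|z s /= /andP[/and3P[]]].
move=> u v Ou Ov uv nuv; have [-> // | /eqP uv'] := eqVneq u v.
have Xu := XN _ _ uv uv'.
have Xv : X i v by apply: XN (not_eq_sym uv'); rewrite (sym_connect_sym Ns).
have [mvu _] := connect_invariant_restrict mN uv.
by apply: connect1; rewrite /NO Xu Xv Ou Ov mvu eqxx; apply/asboolP.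
Qed.

(** * From real weights to natural ones *)

Local Open Scope ring_scope.

Lemma walk_weight_cons (T : finType) (w : T -> T -> R) x y s :
  walk_weight w x (y :: s) = w x y + walk_weight w y s.
Proof. by rewrite /walk_weight /= big_cons. Qed.

Lemma walk_weight_ge0 (T : finType) (e : rel T) (w : T -> T -> R) x s :
  edge_weights e w -> path e x s -> 0 <= walk_weight w x s.
Proof.
move=> ew; elim: s x => [|y s IH] x /=; first by rewrite /walk_weight big_nil.
case/andP=> /ew[xy _] /IH ys; rewrite walk_weight_cons; lra.
Qed.

Lemma walk_weight_le_nat (T : finType) (e : rel T) (w : T -> T -> R) w' k x s :
  (forall u v, e u v -> w u v <= k * (w' u v)%:R) -> path e x s ->
  walk_weight w x s <= k * (nat_weight w' x s)%:R.
Proof.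
move=> ww'; elim: s x => [|y s IH] x /=.
  by rewrite /walk_weight big_nil mulr0.
case/andP=> /ww' xy /IH ys; rewrite walk_weight_cons natrD mulrDr; exact: lerD.
Qed.

Lemma nat_weight_le_walk (T : finType) (e : rel T) (w : T -> T -> R) w' k x s :
  (forall u v, e u v -> (w' u v)%:R <= k * w u v) -> path e x s ->
  (nat_weight w' x s)%:R <= k * walk_weight w x s.
Proof.
move=> ww'; elim: s x => [|y s IH] x /=.
  by rewrite /walk_weight big_nil mulr0.
case/andP=> /ww' xy /IH ys; rewrite walk_weight_cons natrD mulrDr; exact: lerD.
Qed.

Lemma path_light_edges (T : finType) (e : rel T) (w : T -> T -> R) k x s :
  edge_weights e w -> path e x s -> walk_weight w x s < k ->
  path (fun u v => e u v && (w u v < k)) x s.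
Proof.
move=> ew; elim: s x => [|y s IH] x //= /andP[xy ys]; rewrite walk_weight_cons => lt.
have [w0 _] := ew _ _ xy; have ys0 := walk_weight_ge0 ew ys.
by rewrite xy IH // ?andbT /=; lra.
Qed.

Lemma is_minor_subrel (S T : finType) (eH : rel S) (e e' : rel T) :
  subrel e' e -> is_minor eH e' -> is_minor eH e.
Proof.
move=> ee' [B [B0 [Bd [Bc Ba]]]]; exists B; split=> //; split=> //; split.
  move=> u x y xu yu; have [s /andP[/andP[ps ls] sB]] := Bc u x y xu yu.
  by exists s; rewrite /walk (sub_path ee' ps) ls.
by move=> u v /Ba[x [y [xu yv /ee' xy]]]; exists x, y.
Qed.

(** Weights are measured in units of [r / N]; the integer scale is [4 * N], which accounts for the
    factor 4 in the bound. *)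
Lemma K3p_free_control (p : nat) (T : finType) (e : rel T) (w : T -> T -> R) :
  (0 < p)%N -> simple_graph e -> edge_weights e w -> ~ is_minor (Kbip 3 p) e ->
  control_function e w 2 (fun r => 4 * (105 * p%:R) ^+ 2 * r).
Proof.
move=> p0 [es _] ew nomin.
have pR : 0 < (105 * p%:R) ^+ 2 :> R by rewrite exprn_gt0 // mulr_gt0 // ltr0n.
split=> [r r0|r r0]; first by rewrite mulr_gt0 // mulr_gt0.
(* [N] is so large that no edge is lighter than the unit [r / N]; rounding up then at most doubles a
   weight. *)
pose N := (\sum_(x : T) \sum_(y : T) Num.bound (r / w x y)).+1.
have N0 : 0 < N%:R :> R by rewrite ltr0n.
have NP x y : e x y -> r <= w x y * N%:R.
  move=> xy; have [w0 _] := ew _ _ xy.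
  rewrite mulrC -ler_pdivrMr //; apply: ltW.
  apply: lt_le_trans (archi_boundP _) _; first by rewrite divr_ge0 // ltW.
  by rewrite ler_nat /N (bigD1 x) //= [X in (X + _)%N](bigD1 y) //= -addnA leqW ?leq_addr.
pose e' : rel T := fun x y => e x y && (w x y < 2 * r).
pose w' x y := (Num.truncn (w x y * N%:R / r)).+1.
have w'P x y : e x y -> w x y * N%:R / r < (w' x y)%:R <= 2 * (w x y * N%:R / r).
  move=> xy; have [w0 _] := ew _ _ xy.
  have q1 : 1 <= w x y * N%:R / r by rewrite ler_pdivlMr // mul1r NP.
  have /andP[q2 q3] := @truncn_itv _ (w x y * N%:R / r) (le_trans ler01 q1).
  by rewrite /w' q3 -natr1; lra.
have le1 x y : e' x y -> w x y <= r / N%:R * (w' x y)%:R.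
  move=> /andP[xy _]; have /andP[q _] := w'P _ _ xy.
  by rewrite mulrAC ler_pdivlMr // -ler_pdivrMl // mulrC; apply: ltW.
have le2 x y : e' x y -> (w' x y)%:R <= 2 * N%:R / r * w x y.
  move=> /andP[xy _]; have /andP[_ q] := w'P _ _ xy.
  by apply: le_trans q _; rewrite le_eqVlt; apply/orP; left; apply/eqP; ring.
have ew' : nat_weighted e' w'.
  split=> [x y|x y /andP[xy _]]; last by rewrite /w' (ew _ _ xy).2.
  rewrite /e' es; case: (boolP (e y x)) => //= yx.
  by rewrite (ew _ _ yx).2.
(* Real length below [2 * r] becomes integer length at most [4 * N]: one factor 2 comes from the
   rounding, the other from the cutoff [2 * r]. *)
have short (x y : T) s : walk e' x y s -> walk_weight w x s < 2 * r ->
    dist_le e' w' (4 * N) x y.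
  move=> /[dup] sw /andP[ps _] lt; exists s => //.
  rewrite -(ler_nat R) natrM; apply: le_trans (nat_weight_le_walk le2 ps) _.
  rewrite mulrAC ler_pdivrMr //.
  have -> : 4 * N%:R * r = 2 * N%:R * (2 * r) by ring.
  by rewrite ler_wpM2l ?mulr_ge0 ?ler0n // ltW.
have light u v : e' u v -> (w' u v <= 4 * N)%N.
  move=> /[dup] uv /andP[_ lt]; rewrite -(ler_nat R) natrM.
  apply: le_trans (le2 _ _ uv) _; rewrite mulrAC ler_pdivrMr //.
  have -> : 4 * N%:R * r = 2 * N%:R * (2 * r) by ring.
  by rewrite ler_wpM2l ?mulr_ge0 ?ler0n // ltW.
have nomin' : ~ is_minor (Kbip 3 p) e'.
  by move=> /is_minor_subrel H; apply: nomin; apply: H => x y /andP[].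
have [X [Xcov Xbd]] := nat_three_cover ew' light isT p0 nomin'.
pose C i : rel T := fun u v => [&& X i u, X i v & `[< dist_le e' w' (4 * N) u v >]].
have Cs i : symmetric (C i).
  move=> u v; rewrite /C andbCA; congr [&& _, _ & _].
  by apply: asbool_equiv_eq; split; apply: dist_le_sym.
pose comp i x := [set y | connect (C i) x y].
have Xconn i x y : X i x -> connect (C i) x y -> X i y.
  by move=> Xx; apply: (@connect_inv _ _ (fun z => X i z)) => // u v _ /and3P[].
exists (fun i => [set comp i x | x in [pred x | X i x]]); split; last split.
- move=> x; have [i Xi] := Xcov x; exists i, (comp i x); last by rewrite inE.
  by apply/imsetP; exists x.
- move=> i A B /imsetP[a Xa ->] /imsetP[b Xb ->] neq x y; rewrite !inE => ax by_.
  rewrite ltNge; apply: contra neq => le.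
  (* [gdist] is an infimum, so the slack between [r] and [2 * r] supplies an actual walk; all its
     edges are lighter than [2 * r] and survive in [e']. *)
  have : (gdist e w x y < (2 * r)%:E)%E by apply: le_lt_trans le _; rewrite lte_fin; lra.
  case/ereal_inf_lt=> _ [s /= /andP[ps ls] <-]; rewrite lte_fin => lt.
  have ps' := path_light_edges ew ps lt.
  have Cxy : C i x y.
    rewrite /C (Xconn _ _ _ Xa ax) (Xconn _ _ _ Xb by_) /=; apply/asboolP.
    by apply: (short x y s) => //; rewrite /walk ls andbT.
  have cs := sym_connect_sym (Cs i).
  apply/eqP/setP => z; rewrite !inE; apply: same_connect => //.
  apply: connect_trans ax _; apply: connect_trans (connect1 Cxy) _.
  by rewrite cs.
move=> i A /imsetP[a Xa ->] x y; rewrite !inE => ax ay.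
have xy : connect (C i) x y.
  by apply: connect_trans ay; rewrite (sym_connect_sym (Cs i)).
have [|s /andP[ps ls] les] := Xbd i (C i) x y _ (Cs i) xy.
  by move=> u v /and3P[? ? /asboolP].
apply: le_trans (_ : ((walk_weight w x s)%:E <= _)%E).
  apply: ereal_inf_lbound; exists s => //=; rewrite /walk ls andbT.
  by apply: sub_path ps => u v /andP[].
rewrite lee_fin; apply: le_trans (walk_weight_le_nat le1 ps) _.
rewrite mulrAC ler_pdivrMr //.
have {}les : (nat_weight w' x s)%:R <= (105 * p%:R) ^+ 2 * (4 * N%:R) :> R.
  by move: les; rewrite -(ler_nat R) natrM natrX !natrM.
apply: le_trans (ler_wpM2l (ltW r0) les) _; move: (105 * p%:R) => q.
by rewrite le_eqVlt; apply/orP; left; apply/eqP; ring.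
Qed.

Theorem theorem3p5 :
  (* (1) linear-type bound, constant depending on p, D per graph *)
  (forall p : nat, (3 <= p)%N ->
     exists c : R, 0 < c /\
       forall (T : finType) (e : rel T) (w : T -> T -> R),
         simple_graph e -> edge_weights e w ->
         ~ is_minor (Kbip 3%N p) e ->
         exists D : R -> R, control_function e w 2 D /\
           forall r : R, 0 < r -> D r <= c * r + c) /\
  (* (2) edge weights >= eps: bound c(eps) p^2 r, c independent of p *)
  (forall eps : R, 0 < eps ->
     exists c : R, 0 < c /\
       forall p : nat, (3 <= p)%N ->
       forall (T : finType) (e : rel T) (w : T -> T -> R),
         simple_graph e -> edge_weights e w ->
         (forall x y, e x y -> eps <= w x y) ->
         ~ is_minor (Kbip 3%N p) e ->
         exists D : R -> R, control_function e w 2 D /\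
           forall r : R, 0 < r -> D r <= c * (p%:R ^+ 2) * r) /\
  (* (3) asymptotic dimension <= 2 of linear type for the weighted class *)
  (forall p : nat, (3 <= p)%N ->
     exists c : R, 0 < c /\ exists D : R -> R,
       (forall r : R, 0 < r -> D r <= c * r + c) /\
       forall (T : finType) (e : rel T) (w : T -> T -> R),
         simple_graph e -> edge_weights e w ->
         ~ is_minor (Kbip 3%N p) e ->
         control_function e w 2 D) /\
  (* (4) Assouad-Nagata dimension <= 2 for the unweighted class *)
  (forall p : nat, (3 <= p)%N ->
     exists c : R, 0 < c /\ exists D : R -> R,
       (forall r : R, 0 < r -> D r <= c * r) /\
       forall (T : finType) (e : rel T),
         simple_graph e ->
         ~ is_minor (Kbip 3%N p) e ->
         control_function e (fun _ _ => 1) 2 D).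
Proof.
have c0 p : (3 <= p)%N -> 0 < 4 * (105 * p%:R) ^+ 2 :> R.
  by move=> p3; rewrite mulr_gt0 // exprn_gt0 // mulr_gt0 // ltr0n; lia.
have ctl p (p3 : (3 <= p)%N) := @K3p_free_control p _ _ _ (leq_trans (isT : (0 < 3)%N) p3).
split; [|split; [|split]].
- move=> p p3; exists (4 * (105 * p%:R) ^+ 2); split=> [|T e w sg ew nm]; first exact: c0.
  exists (fun r => 4 * (105 * p%:R) ^+ 2 * r); split; first exact: ctl.
  by move=> r _; rewrite lerDl ltW ?c0.
(* The factor [p ^ 2] splits off from [(105 * p) ^ 2], leaving a constant independent of [p]. *)
- move=> eps _; exists (4 * 105 ^+ 2); split=> [|p p3]; first by rewrite mulr_gt0 // exprn_gt0.
  move=> T e w sg ew _ nm.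
  by exists (fun r => 4 * (105 * p%:R) ^+ 2 * r); split; [exact: ctl | move=> r _; rewrite exprMn mulrA].
- move=> p p3; exists (4 * (105 * p%:R) ^+ 2); split; first exact: c0.
  exists (fun r => 4 * (105 * p%:R) ^+ 2 * r); split=> [r _|T e w sg ew nm].
    by rewrite lerDl ltW ?c0.
  exact: ctl.
move=> p p3; exists (4 * (105 * p%:R) ^+ 2); split; first exact: c0.
exists (fun r => 4 * (105 * p%:R) ^+ 2 * r); split=> // T e sg nm.
by apply: ctl => // x y _; split=> //; apply: ltr01.
Qed.
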